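(* For every integer $n\geq 5$, $\Pi(n)\geq \left\lceil \frac{n-2}{60}\right\rceil$. That is, for every simple polygon $P$ and every set $S$ of $n$ points of $P$ in general position, there exist $u,v\in S$ such that every geodesic disk through $u$ and $v$ contains at least $\left\lceil \frac{n-2}{60}\right\rceil$ points of $S$.
   Context: $P$ is a simple polygon (a closed region). For $a,b\in P$, $g(a,b)$ denotes the shortest (geodesic) path from $a$ to $b$ inside $P$ and $|g(a,b)|$ its length. A geodesic disk with center $c$ and radius $r$ is $D(c,r)=\{x\in P:|g(c,x)|\le r\}$; it is ''through'' some points if those points lie on its boundary (distance exactly $r$ from $c$), and contains a point if the point belongs to it. General position of $S$: no three points of $S$ are geodesically collinear (one on the geodesic path between the other two), no four points among $S$ and the vertices of $P$ lie on the boundary of a common geodesic disk, there are no $x,y\in S$ and reflex vertex $p$ of $P$ with $y\in g(x,p)$, and no geodesic bisector (set of points equidistant from two points) of two points of $S$ passes through a vertex of $P$. $\Pi(n)$ is the largest integer such that for every simple polygon $P$ and every set $S$ of $n$ points of $P$ in general position, there exist $u,v\in S$ such that every geodesic disk through $u$ and $v$ contains at least $\Pi(n)$ points of $S$. *)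

(* Defs.v *)
From Stdlib Require Import Reals Lra List.
From Coquelicot Require Import Coquelicot.
Import ListNotations.
Open Scope R_scope.

Definition point : Type := (R * R)%type.

Definition dist (p q : point) : R :=
  sqrt ((fst p - fst q) ^ 2 + (snd p - snd q) ^ 2).

Definition lerp (p q : point) (t : R) : point :=
  ((1 - t) * fst p + t * fst q, (1 - t) * snd p + t * snd q).

Definition on_seg (p q x : point) : Prop :=
  exists t, 0 <= t <= 1 /\ x = lerp p q t.

(** A polygon is given by the (cyclic) list of its vertices. *)
Definition vtx (V : list point) (i : nat) : point := nth i V (0, 0).
Definition nxt (V : list point) (i : nat) : nat := (S i) mod (length V).
Definition prv (V : list point) (i : nat) : nat := (i + length V - 1) mod (length V).

Definition on_edge (V : list point) (i : nat) (x : point) : Prop :=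
  on_seg (vtx V i) (vtx V (nxt V i)) x.

Definition on_boundary (V : list point) (x : point) : Prop :=
  exists i, (i < length V)%nat /\ on_edge V i x.

Definition simple_polygon (V : list point) : Prop :=
  (3 <= length V)%nat /\ NoDup V /\
  forall i j x, (i < length V)%nat -> (j < length V)%nat -> i <> j ->
    on_edge V i x -> on_edge V j x ->
    (j = nxt V i /\ x = vtx V j) \/ (i = nxt V j /\ x = vtx V i).

Definition continuous_curve (g : R -> point) : Prop :=
  forall t, 0 <= t <= 1 -> forall eps, 0 < eps ->
    exists delta, 0 < delta /\
      forall s, 0 <= s <= 1 -> Rabs (s - t) < delta -> dist (g s) (g t) < eps.

(** [x] lies in the unbounded component of the complement of the boundary:
    from [x] one can reach arbitrarily far points by continuous curves
    avoiding the boundary. *)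
Definition escapes (V : list point) (x : point) : Prop :=
  forall M : R, exists g : R -> point,
    continuous_curve g /\ g 0 = x /\ dist (g 1) (0, 0) > M /\
    forall t, 0 <= t <= 1 -> ~ on_boundary V (g t).

(** The closed region P bounded by the polygon (boundary plus interior). *)
Definition in_poly (V : list point) (x : point) : Prop := ~ escapes V x.

Fixpoint chain_len (a : point) (l : list point) : R :=
  match l with
  | [] => 0
  | q :: l' => dist a q + chain_len q l'
  end.

Fixpoint chain_inside (V : list point) (a : point) (l : list point) : Prop :=
  match l with
  | [] => True
  | q :: l' =>
      (forall t, 0 <= t <= 1 -> in_poly V (lerp a q t)) /\ chain_inside V q l'
  end.

(** Geodesic distance |g(a,b)| inside P: infimum of lengths of polygonal
    paths from a to b contained in P (the shortest path in a simple polygon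
    is polygonal, so this infimum is attained and is the geodesic length). *)
Definition gdist (V : list point) (a b : point) : R :=
  real (Glb_Rbar (fun l => exists pts : list point,
          chain_inside V a (pts ++ [b]) /\ l = chain_len a (pts ++ [b]))).

Definition on_geodesic (V : list point) (a b y : point) : Prop :=
  in_poly V y /\ gdist V a y + gdist V y b = gdist V a b.

(** Reflex vertex: interior angle > pi, detected via the sign of the turn at
    v_i relative to the orientation (signed area) of the polygon. *)
Definition cross3 (a b c : point) : R :=
  (fst b - fst a) * (snd c - snd b) - (snd b - snd a) * (fst c - fst b).

Definition area2 (V : list point) : R :=
  fold_right Rplus 0
    (map (fun i => fst (vtx V i) * snd (vtx V (nxt V i))
                   - fst (vtx V (nxt V i)) * snd (vtx V i))
         (seq 0 (length V))).

Definition reflex_vertex (V : list point) (p : point) : Prop :=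
  exists i, (i < length V)%nat /\ p = vtx V i /\
    cross3 (vtx V (prv V i)) (vtx V i) (vtx V (nxt V i)) * area2 V < 0.

Definition general_position (V : list point) (S : list point) : Prop :=
  (forall x y z, In x S -> In y S -> In z S -> x <> y -> y <> z -> x <> z ->
     ~ on_geodesic V x z y) /\
  (forall a1 a2 a3 a4 : point,
     (In a1 S \/ In a1 V) -> (In a2 S \/ In a2 V) ->
     (In a3 S \/ In a3 V) -> (In a4 S \/ In a4 V) ->
     NoDup [a1; a2; a3; a4] ->
     ~ (exists c r, in_poly V c /\
          gdist V c a1 = r /\ gdist V c a2 = r /\
          gdist V c a3 = r /\ gdist V c a4 = r)) /\
  (forall x y p, In x S -> In y S -> x <> y -> reflex_vertex V p ->
     ~ on_geodesic V x p y) /\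
  (* no geodesic bisector of two points of S passes through a vertex *)
  (forall x y p, In x S -> In y S -> x <> y -> In p V ->
     gdist V x p <> gdist V y p).

Definition count_in_disk (V : list point) (S : list point) (c : point) (r : R) : nat :=
  length (filter (fun s => if Rle_dec (gdist V c s) r then true else false) S).

Definition ceil_div (a b : nat) : nat := (a + b - 1) / b.

(* Main.v *)
(** Suppose that every pair [u], [v] of points of [S] admits a geodesic disk
    through [u] and [v] with fewer than [ceil ((n - 2) / 60)] points. By a union
    bound over 5-tuples, some five distinct points of [S] are such that the disk
    chosen for each pair misses the other three. Draw the edge [uv] of [K_5] as
    two almost shortest chains from the center of its disk to [u] and to [v]. If
    two independent edges met, exchanging tails at the common point would give a
    chain from one of the centers to a point outside its disk that is too short.
    So independent edges are disjoint, which is impossible for a drawing of [K_5].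

    The latter is a parity count. For disjoint curves from [u] to [v] and from
    [w] to [z], consider the rightward horizontal rays issued from the four
    endpoints. The number of crossings of each curve with the rays issued from
    the endpoints of the other is odd in total exactly when the heights of
    [u], [v] interleave with those of [w], [z]. Summed over the fifteen
    independent pairs of edges of [K_5] the crossings cancel modulo 2, whereas
    each 4-subset of vertices has exactly one interleaving pairing. *)

From Stdlib Require Import Reals Lra Lia List Arith Bool Ring.
From Stdlib Require Import ClassicalEpsilon FunctionalExtensionality.
From Coquelicot Require Import Coquelicot.
Require Import Defs.
Import ListNotations.
Open Scope R_scope.

(** * Truth values and segments *)

(** Boolean truth values turn counting modulo 2 into [xorb] identities, which [ring] proves. *)
Definition holds (P : Prop) : bool :=
  if excluded_middle_informative P then true else false.

Lemma holds_true (P : Prop) : P -> holds P = true.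
Proof. unfold holds; destruct (excluded_middle_informative P); tauto. Qed.

Lemma holds_false (P : Prop) : ~ P -> holds P = false.
Proof. unfold holds; destruct (excluded_middle_informative P); tauto. Qed.

Lemma holds_iff (P Q : Prop) : (P <-> Q) -> holds P = holds Q.
Proof.
  intros H; unfold holds.
  destruct (excluded_middle_informative P), (excluded_middle_informative Q); tauto.
Qed.

Lemma holds_not (P : Prop) : holds (~ P) = negb (holds P).
Proof.
  unfold holds.
  destruct (excluded_middle_informative P), (excluded_middle_informative (~ P)); tauto.
Qed.

Lemma point_eq (p q : point) : fst p = fst q -> snd p = snd q -> p = q.
Proof. destruct p, q; simpl; congruence. Qed.

Lemma lerp_0 (p q : point) : lerp p q 0 = p.
Proof. apply point_eq; simpl; ring. Qed.

Lemma lerp_1 (p q : point) : lerp p q 1 = q.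
Proof. apply point_eq; simpl; ring. Qed.

Lemma lerp_flip (p q : point) (t : R) : lerp q p t = lerp p q (1 - t).
Proof. apply point_eq; simpl; ring. Qed.

Lemma on_seg_flip (p q x : point) : on_seg q p x -> on_seg p q x.
Proof.
  intros [t [Ht ->]]. exists (1 - t). split; [lra | apply lerp_flip].
Qed.

Lemma on_seg_l (p q : point) : on_seg p q p.
Proof. exists 0; rewrite lerp_0; split; [lra | easy]. Qed.

Lemma on_seg_r (p q : point) : on_seg p q q.
Proof. exists 1; rewrite lerp_1; split; [lra | easy]. Qed.

(** * Ray crossing parity of disjoint segments *)

(* Breaking ties of height by the abscissa amounts to tilting the horizontal
   rays infinitesimally, so that no general position assumption is needed. *)
Definition below (p q : point) : Prop :=
  snd p < snd q \/ (snd p = snd q /\ fst p < fst q).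

(** One disjunct for each vertical orientation of the segment: directed upwards, it has [p] strictly
    on its left, so the rightward ray from [p] crosses it. *)
Definition ray_hits (p r s : point) : Prop :=
  (below r p /\ below p s /\ 0 < cross3 r s p) \/
  (below s p /\ below p r /\ 0 < cross3 s r p).

Lemma below_irrefl (p : point) : ~ below p p.
Proof. unfold below; lra. Qed.

Lemma below_trans (p q r : point) : below p q -> below q r -> below p r.
Proof. unfold below; lra. Qed.

Lemma below_total (p q : point) : p <> q -> below p q \/ below q p.
Proof.
  intros H; unfold below.
  destruct (Rtotal_order (snd p) (snd q)) as [? | [? | ?]]; [lra | | lra].
  destruct (Rtotal_order (fst p) (fst q)) as [? | [? | ?]]; [lra | | lra].
  destruct H; now apply point_eq.
Qed.

Lemma holds_below_flip (p q : point) :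
  p <> q -> holds (below q p) = negb (holds (below p q)).
Proof.
  intros H. rewrite <- holds_not. apply holds_iff.
  pose proof (below_total p q H). pose proof (below_trans p q p).
  pose proof (below_irrefl p). tauto.
Qed.

Lemma below_lerp (p r s : point) (t : R) :
  below p r -> below p s -> 0 <= t <= 1 -> below p (lerp r s t).
Proof.
  unfold below; intros Hr Hs Ht; simpl.
  destruct (Req_dec t 0) as [-> | H0]; [lra |].
  destruct (Req_dec t 1) as [-> | H1]; [lra |].
  destruct Hr as [Hr | [Hr Hr']], Hs as [Hs | [Hs Hs']]; [left; nra ..|].
  right; split; nra.
Qed.

Lemma lerp_below (q r s : point) (t : R) :
  below r q -> below s q -> 0 <= t <= 1 -> below (lerp r s t) q.
Proof.
  unfold below; intros Hr Hs Ht; simpl.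
  destruct (Req_dec t 0) as [-> | H0]; [lra |].
  destruct (Req_dec t 1) as [-> | H1]; [lra |].
  destruct Hr as [Hr | [Hr Hr']], Hs as [Hs | [Hs Hs']]; [left; nra ..|].
  right; split; nra.
Qed.

Lemma collinear_on_seg (p q x : point) :
  below p x -> below x q -> cross3 p q x = 0 -> on_seg p q x.
Proof.
  unfold below, cross3; intros Hp Hq H.
  (* A horizontal segment is parametrized by the abscissa, any other by the height. *)
  destruct (Req_dec (snd p) (snd q)) as [E | E].
  - assert (Ex : snd x = snd p) by lra.
    exists ((fst x - fst p) / (fst q - fst p)). split.
    + split; [apply Rmult_le_pos; [lra | left; apply Rinv_0_lt_compat; lra] |].
      apply (Rmult_le_reg_r (fst q - fst p)); [lra |].
      unfold Rdiv; rewrite Rmult_assoc, Rinv_l; lra.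
    + apply point_eq; simpl; [field; lra | rewrite <- E, Ex; field; lra].
  - exists ((snd x - snd p) / (snd q - snd p)). split.
    + split; [apply Rmult_le_pos; [lra | left; apply Rinv_0_lt_compat; lra] |].
      apply (Rmult_le_reg_r (snd q - snd p)); [lra |].
      unfold Rdiv; rewrite Rmult_assoc, Rinv_l; lra.
    + apply point_eq; simpl; [| field; lra].
      apply (Rmult_eq_reg_r (snd q - snd p)); [| lra].
      field_simplify; lra.
Qed.

Definition seg_disjoint (p q r s : point) : Prop :=
  forall x, on_seg p q x -> on_seg r s x -> False.

Lemma seg_disjoint_sym (p q r s : point) : seg_disjoint p q r s -> seg_disjoint r s p q.
Proof. intros H x H1 H2; exact (H x H2 H1). Qed.

Lemma seg_disjoint_flip (p q r s : point) : seg_disjoint p q r s -> seg_disjoint q p r s.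
Proof. intros H x H1 H2; exact (H x (on_seg_flip _ _ _ H1) H2). Qed.

(** [cross3 p q] is affine along [rs]. A change of sign would give a zero there, between [p] and [q]
    in the vertical order, hence a point of [pq]. *)
Lemma nested_segments_side (p q r s : point) :
  seg_disjoint p q r s -> below p r -> below r q -> below p s -> below s q ->
  0 < cross3 p q r -> 0 < cross3 p q s.
Proof.
  intros D Hpr Hrq Hps Hsq Hr.
  destruct (Rlt_le_dec 0 (cross3 p q s)) as [| Hs]; [assumption | exfalso].
  set (t := cross3 p q r / (cross3 p q r - cross3 p q s)).
  assert (Ht : 0 <= t <= 1).
  { split; [apply Rmult_le_pos; [lra | left; apply Rinv_0_lt_compat; lra] |].
    apply (Rmult_le_reg_r (cross3 p q r - cross3 p q s)); [lra |].
    unfold t, Rdiv; rewrite Rmult_assoc, Rinv_l; lra. }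
  apply (D (lerp r s t)); [| now exists t].
  apply collinear_on_seg; [now apply below_lerp | now apply lerp_below |].
  transitivity ((1 - t) * cross3 p q r + t * cross3 p q s).
  - unfold cross3; simpl; ring.
  - unfold t; field; lra.
Qed.

(* With [a = q - p], [b = s - r], [c = q - r] the hypotheses put [c] strictly
   inside the cone spanned by [a] and [b]; its coordinates in this basis give
   the intersection point, and the vertical order bounds them by [1]. *)
Lemma interleaved_segments_side (sg : R) (p q r s : point) :
  seg_disjoint p q r s -> below p r -> below r q -> below q s ->
  sg = 1 \/ sg = -1 ->
  0 < sg * cross3 p q r -> 0 < sg * cross3 r s q -> False.
Proof.
  intros D Hpr Hrq Hqs Hsg H1 H2.
  set (ax := fst q - fst p); set (ay := snd q - snd p).
  set (bx := fst s - fst r); set (by_ := snd s - snd r).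
  set (cx := fst q - fst r); set (cy := snd q - snd r).
  assert (H1' : 0 < sg * (cx * ay - cy * ax)).
  { replace (cx * ay - cy * ax) with (cross3 p q r); [easy |].
    unfold cross3, cx, cy, ax, ay; ring. }
  assert (H2' : 0 < sg * (bx * cy - by_ * cx)).
  { replace (bx * cy - by_ * cx) with (cross3 r s q); [easy |].
    unfold cross3, cx, cy, bx, by_; ring. }
  assert (Pc : 0 < cy \/ (cy = 0 /\ 0 < cx)) by (unfold below in *; unfold cx, cy; lra).
  assert (Pac : 0 < ay - cy \/ (ay - cy = 0 /\ 0 < ax - cx))
    by (unfold below in *; unfold ax, ay, cx, cy; lra).
  assert (Pbc : 0 < by_ - cy \/ (by_ - cy = 0 /\ 0 < bx - cx))
    by (unfold below in *; unfold bx, by_, cx, cy; lra).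
  assert (Ex : fst r = fst q - cx) by (unfold cx; ring).
  assert (Ey : snd r = snd q - cy) by (unfold cy; ring).
  assert (Fx : fst p = fst q - ax) by (unfold ax; ring).
  assert (Fy : snd p = snd q - ay) by (unfold ay; ring).
  assert (Gx : fst s = fst q - cx + bx) by (unfold bx, cx; ring).
  assert (Gy : snd s = snd q - cy + by_) by (unfold by_, cy; ring).
  clearbody ax ay bx by_ cx cy.
  (* Cramer's rule: [c = (k / d) a + (m / d) b], so the common point is
     [q - (k / d) a = r + (m / d) b]. The sign [sg] treats both orientations in one computation. *)
  set (m := sg * (cx * ay - cy * ax)) in *; set (k := sg * (bx * cy - by_ * cx)) in *.
  set (d := sg * (bx * ay - by_ * ax)).
  assert (Py : d * cy = k * ay + m * by_) by (unfold d, k, m; ring).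
  assert (Px : d * cx = k * ax + m * bx) by (unfold d, k, m; ring).
  assert (Hd : 0 < d).
  { destruct Pc as [Pc | [Pc Pc']].
    - apply (Rmult_lt_reg_r cy); [easy |]. rewrite Py. nra.
    - exfalso. assert (ay = 0 /\ by_ = 0) as [E E'] by nra.
      unfold m in H1'. rewrite Pc, E in H1'. lra. }
  assert (Ht : m < d).
  { apply Rnot_le_lt; intros L. destruct Pbc as [Q | [Q Q']], Pc as [Pc | [Pc Pc']]; nra. }
  assert (Hv : k < d).
  { apply Rnot_le_lt; intros L. destruct Pac as [Q | [Q Q']], Pc as [Pc | [Pc Pc']]; nra. }
  clearbody d m k.
  apply (D (lerp r s (m / d))).
  - exists (1 - k / d). split.
    + assert (0 < k / d) by (apply Rdiv_lt_0_compat; lra).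
      assert (k / d < 1).
      { apply (Rmult_lt_reg_r d); [lra |]. unfold Rdiv; rewrite Rmult_assoc, Rinv_l; lra. }
      lra.
    + apply point_eq; simpl; rewrite ?Ex, ?Ey, ?Fx, ?Fy, ?Gx, ?Gy;
        apply (Rmult_eq_reg_r d); try lra; field_simplify; lra.
  - exists (m / d). split; [| easy].
    assert (0 < m / d) by (apply Rdiv_lt_0_compat; lra).
    assert (m / d < 1).
    { apply (Rmult_lt_reg_r d); [lra |]. unfold Rdiv; rewrite Rmult_assoc, Rinv_l; lra. }
    lra.
Qed.

Lemma ray_hits_flip (p r s : point) : holds (ray_hits p s r) = holds (ray_hits p r s).
Proof. apply holds_iff; unfold ray_hits; tauto. Qed.

Lemma ray_hits_between (p r s : point) :
  below r p -> below p s -> holds (ray_hits p r s) = holds (0 < cross3 r s p).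
Proof.
  intros H1 H2. apply holds_iff; unfold ray_hits. split; [| tauto].
  intros [H | [H _]]; [tauto |].
  destruct (below_irrefl p). exact (below_trans _ _ _ H2 H).
Qed.

Lemma ray_misses_above (p r s : point) :
  below r p -> below s p -> holds (ray_hits p r s) = false.
Proof.
  intros H1 H2. apply holds_false. pose proof (below_irrefl p).
  pose proof (below_trans p s p). pose proof (below_trans p r p).
  unfold ray_hits; tauto.
Qed.

Lemma ray_misses_below (p r s : point) :
  below p r -> below p s -> holds (ray_hits p r s) = false.
Proof.
  intros H1 H2. apply holds_false. pose proof (below_irrefl p).
  pose proof (below_trans p s p). pose proof (below_trans p r p).
  unfold ray_hits; tauto.
Qed.

(** Writing interleaving as a sum of four comparisons lets these identities telescope along chains:
    the terms at inner vertices cancel. *)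
Definition seg_parity (p q r s : point) : Prop :=
  xorb (xorb (holds (ray_hits r p q)) (holds (ray_hits s p q)))
       (xorb (holds (ray_hits p r s)) (holds (ray_hits q r s))) =
  xorb (xorb (holds (below p r)) (holds (below p s)))
       (xorb (holds (below q r)) (holds (below q s))).

Lemma seg_parity_flip (p q r s : point) : seg_parity p q r s -> seg_parity q p r s.
Proof.
  unfold seg_parity. rewrite (ray_hits_flip r p q), (ray_hits_flip s p q).
  intros H.
  match type of H with ?L = ?R => transitivity L; [ring | transitivity R; [exact H | ring]] end.
Qed.

(** The exchange negates all four comparisons of heights, an even number. *)
Lemma seg_parity_sym (p q r s : point) :
  p <> r -> p <> s -> q <> r -> q <> s -> seg_parity p q r s -> seg_parity r s p q.
Proof.
  unfold seg_parity; intros n1 n2 n3 n4 H.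
  rewrite (holds_below_flip p r), (holds_below_flip p s), (holds_below_flip q r),
    (holds_below_flip q s) by easy.
  match type of H with ?L = ?R =>
    transitivity L; [ring | transitivity R; [exact H |]] end.
  destruct (holds (below p r)), (holds (below p s)), (holds (below q r)),
    (holds (below q s)); reflexivity.
Qed.

(** With [p] lowest, [q] has three positions. Below [r], no ray hits. Between [r] and [s], exactly
    one of the rays from [r] and [q] hits, or the segments would meet. Above [s], the rays from [r]
    and [s] both hit [pq] or both miss it. *)
Lemma seg_parity_ordered (p q r s : point) :
  seg_disjoint p q r s -> below p q -> below r s -> below p r -> seg_parity p q r s.
Proof.
  intros D Hpq Hrs Hpr. unfold seg_parity.
  assert (Hps : below p s) by exact (below_trans _ _ _ Hpr Hrs).
  assert (nqr : q <> r) by (intros ->; exact (D r (on_seg_r _ _) (on_seg_l _ _))).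
  assert (nqs : q <> s) by (intros ->; exact (D s (on_seg_r _ _) (on_seg_r _ _))).
  rewrite (holds_true (below p r)), (holds_true (below p s)) by easy.
  rewrite (ray_misses_below p r s) by easy.
  destruct (below_total _ _ nqr) as [Hqr | Hrq].
  - assert (Hqs : below q s) by exact (below_trans _ _ _ Hqr Hrs).
    rewrite (holds_true (below q r)), (holds_true (below q s)) by easy.
    rewrite (ray_misses_above r), (ray_misses_above s), (ray_misses_below q) by easy.
    reflexivity.
  - rewrite (holds_below_flip r q), (holds_true (below r q)) by easy || now apply not_eq_sym.
    rewrite (ray_hits_between r) by easy.
    destruct (below_total _ _ nqs) as [Hqs | Hsq].
    + rewrite (holds_true (below q s)), (ray_misses_above s), (ray_hits_between q) by easy.
      rewrite (holds_iff (0 < cross3 p q r) (~ 0 < cross3 r s q)).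
      { rewrite holds_not. destruct (holds (0 < cross3 r s q)); reflexivity. }
      split.
      * intros H1 H2.
        apply (interleaved_segments_side 1 p q r s); try easy; [now left | lra | lra].
      * intros H2. apply Rnot_le_lt; intros H1.
        assert (cross3 p q r <> 0).
        { intros E. exact (D r (collinear_on_seg _ _ _ Hpr Hrq E) (on_seg_l _ _)). }
        assert (cross3 r s q <> 0).
        { intros E. exact (D q (on_seg_r _ _) (collinear_on_seg _ _ _ Hrq Hqs E)). }
        apply (interleaved_segments_side (-1) p q r s); try easy; [now right | lra | lra].
    + rewrite (holds_false (below q s)), (ray_misses_above q), (ray_hits_between s);
        try easy.
      2: { intros H; exact (below_irrefl _ (below_trans _ _ _ H Hsq)). }
      rewrite (holds_iff (0 < cross3 p q r) (0 < cross3 p q s)).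
      { destruct (holds (0 < cross3 p q s)); reflexivity. }
      split.
      * now apply nested_segments_side.
      * apply nested_segments_side; try easy.
        apply seg_disjoint_sym, seg_disjoint_flip, seg_disjoint_sym, D.
Qed.

(** Flipping and exchanging the segments reduces to the ordered case. A degenerate segment is hit by
    no ray, and its coinciding endpoints contribute equal terms that cancel. *)
Lemma disjoint_seg_parity (p q r s : point) : seg_disjoint p q r s -> seg_parity p q r s.
Proof.
  assert (W1 : forall p q r s, seg_disjoint p q r s -> below p q -> below r s ->
    seg_parity p q r s).
  { clear; intros p q r s D Hpq Hrs.
    assert (npr : p <> r) by (intros ->; exact (D r (on_seg_l _ _) (on_seg_l _ _))).
    assert (nps : p <> s) by (intros ->; exact (D s (on_seg_l _ _) (on_seg_r _ _))).
    assert (nqr : q <> r) by (intros ->; exact (D r (on_seg_r _ _) (on_seg_l _ _))).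
    assert (nqs : q <> s) by (intros ->; exact (D s (on_seg_r _ _) (on_seg_r _ _))).
    destruct (below_total _ _ npr); [now apply seg_parity_ordered |].
    apply seg_parity_sym; try now apply not_eq_sym.
    apply seg_parity_ordered; try easy. now apply seg_disjoint_sym. }
  assert (W2 : forall p q r s, seg_disjoint p q r s -> below r s -> seg_parity p q r s).
  { clear - W1; intros p q r s D Hrs.
    destruct (excluded_middle_informative (p = q)) as [<- | npq].
    - unfold seg_parity, ray_hits.
      rewrite (holds_false ((below p r /\ _) \/ _)), (holds_false ((below p s /\ _) \/ _)).
      + ring.
      + unfold cross3; lra.
      + unfold cross3; lra.
    - destruct (below_total _ _ npq); [now apply W1 |].
      apply seg_parity_flip, W1; try easy. now apply seg_disjoint_flip. }
  intros D.
  assert (npr : p <> r) by (intros ->; exact (D r (on_seg_l _ _) (on_seg_l _ _))).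
  assert (nps : p <> s) by (intros ->; exact (D s (on_seg_l _ _) (on_seg_r _ _))).
  assert (nqr : q <> r) by (intros ->; exact (D r (on_seg_r _ _) (on_seg_l _ _))).
  assert (nqs : q <> s) by (intros ->; exact (D s (on_seg_r _ _) (on_seg_r _ _))).
  destruct (excluded_middle_informative (r = s)) as [<- | nrs].
  - unfold seg_parity.
    rewrite (holds_false (ray_hits p r r)), (holds_false (ray_hits q r r)).
    + ring.
    + unfold ray_hits, cross3; lra.
    + unfold ray_hits, cross3; lra.
  - destruct (below_total _ _ nrs); [now apply W2 |].
    apply seg_parity_sym; try now apply not_eq_sym.
    apply seg_parity_flip, seg_parity_sym; try easy.
    apply W2; [| easy].
    now apply seg_disjoint_sym, seg_disjoint_flip, seg_disjoint_sym.
Qed.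

(** * Parity of drawings of the complete graph on five vertices *)

Lemma last_cons (A : Type) (l : list A) (a b : A) : last (a :: l) b = last l a.
Proof.
  revert a b; induction l as [| c l IH]; intros a b; [easy |].
  exact (eq_trans (IH c b) (eq_sym (IH c a))).
Qed.

Fixpoint on_chain (a : point) (l : list point) (x : point) : Prop :=
  match l with
  | [] => False
  | q :: l' => on_seg a q x \/ on_chain q l' x
  end.

Fixpoint ray_parity (p a : point) (l : list point) : bool :=
  match l with
  | [] => false
  | q :: l' => xorb (holds (ray_hits p a q)) (ray_parity p q l')
  end.

Definition chain_disjoint (a : point) (l : list point) (b : point) (l' : list point) :=
  forall x, on_chain a l x -> on_chain b l' x -> False.

(** The identities of the successive segments add up; every inner vertex of the chain occurs in two
    of them and cancels. *)
Lemma seg_chain_parity (p q b : point) (l : list point) :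
  (forall x, on_seg p q x -> on_chain b l x -> False) ->
  xorb (xorb (holds (ray_hits b p q)) (holds (ray_hits (last l b) p q)))
       (xorb (ray_parity p b l) (ray_parity q b l)) =
  xorb (xorb (holds (below p b)) (holds (below p (last l b))))
       (xorb (holds (below q b)) (holds (below q (last l b)))).
Proof.
  revert b; induction l as [| c l IH]; intros b D.
  - simpl. ring.
  - assert (D1 : seg_parity p q b c).
    { apply disjoint_seg_parity; intros x H1 H2; apply (D x H1); now left. }
    assert (D2 := IH c (fun x H1 H2 => D x H1 (or_intror H2))).
    rewrite last_cons.
    pose proof (f_equal2 xorb D1 D2) as H.
    match type of H with ?L = ?R =>
      transitivity L; [simpl; ring | transitivity R; [exact H | ring]] end.
Qed.

Lemma chain_chain_parity (a b : point) (l l' : list point) :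
  chain_disjoint a l b l' ->
  xorb (xorb (ray_parity b a l) (ray_parity (last l' b) a l))
       (xorb (ray_parity a b l') (ray_parity (last l a) b l')) =
  xorb (xorb (holds (below a b)) (holds (below a (last l' b))))
       (xorb (holds (below (last l a) b)) (holds (below (last l a) (last l' b)))).
Proof.
  revert a; induction l as [| c l IH]; intros a D.
  - simpl. ring.
  - assert (D1 := seg_chain_parity a c b l' (fun x H1 H2 => D x (or_introl H1) H2)).
    assert (D2 := IH c (fun x H1 H2 => D x (or_intror H1) H2)).
    rewrite last_cons.
    pose proof (f_equal2 xorb D1 D2) as H.
    match type of H with ?L = ?R =>
      transitivity L; [simpl; ring | transitivity R; [exact H | ring]] end.
Qed.

(* An edge joining [u] to [v] is drawn as two chains leaving a common hub. *)
Lemma edge_parity (c d u v w z : point) (lu lv lw lz : list point) :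
  last lu c = u -> last lv c = v -> last lw d = w -> last lz d = z ->
  chain_disjoint c lu d lw -> chain_disjoint c lu d lz ->
  chain_disjoint c lv d lw -> chain_disjoint c lv d lz ->
  xorb (xorb (xorb (ray_parity w c lu) (ray_parity w c lv))
             (xorb (ray_parity z c lu) (ray_parity z c lv)))
       (xorb (xorb (ray_parity u d lw) (ray_parity u d lz))
             (xorb (ray_parity v d lw) (ray_parity v d lz))) =
  xorb (xorb (holds (below u w)) (holds (below u z)))
       (xorb (holds (below v w)) (holds (below v z))).
Proof.
  intros Eu Ev Ew Ez D1 D2 D3 D4.
  apply chain_chain_parity in D1, D2, D3, D4.
  rewrite Eu, Ew in D1; rewrite Eu, Ez in D2; rewrite Ev, Ew in D3; rewrite Ev, Ez in D4.
  pose proof (f_equal2 xorb (f_equal2 xorb D1 D2) (f_equal2 xorb D3 D4)) as H.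
  match type of H with ?L = ?R =>
    transitivity L; [ring | transitivity R; [exact H | ring]] end.
Qed.

(* In the sum of the fifteen equations every [e i j k] occurs twice, while each
   of the five 4-subsets contributes an odd number of interleaved pairings. *)
Lemma K5_parity_contradiction (e : nat -> nat -> nat -> bool) (b : nat -> nat -> bool) :
  (forall i j, (j < i < 5)%nat -> b i j = xorb true (b j i)) ->
  (forall i j k l, (i < j < 5)%nat -> (k < l < 5)%nat ->
     i <> k -> i <> l -> j <> k -> j <> l ->
     xorb (xorb (e i j k) (e i j l)) (xorb (e k l i) (e k l j)) =
     xorb (xorb (b i k) (b i l)) (xorb (b j k) (b j l))) -> False.
Proof.
  intros Hb H.
  assert (H' : forall i j k l : nat,
     ((i <? j) && (j <? 5) && (k <? l) && (l <? 5) &&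
      negb (i =? k) && negb (i =? l) && negb (j =? k) && negb (j =? l))%nat = true ->
     xorb (xorb (e i j k) (e i j l)) (xorb (e k l i) (e k l j)) =
     xorb (xorb (b i k) (b i l)) (xorb (b j k) (b j l))).
  { intros i j k l Q.
    rewrite !andb_true_iff, !negb_true_iff, !Nat.ltb_lt, !Nat.eqb_neq in Q.
    apply H; tauto. }
  (* [Q4] adds the three pairings of the 4-subset omitting [4], and so on down to [Q0]. *)
  pose proof ((f_equal2 xorb (H' 0 1 2 3 eq_refl) (f_equal2 xorb (H' 0 2 1 3 eq_refl)
   (H' 0 3 1 2 eq_refl)))%nat) as Q4.
  pose proof ((f_equal2 xorb (H' 0 1 2 4 eq_refl) (f_equal2 xorb (H' 0 2 1 4 eq_refl)
   (H' 0 4 1 2 eq_refl)))%nat) as Q3.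
  pose proof ((f_equal2 xorb (H' 0 1 3 4 eq_refl) (f_equal2 xorb (H' 0 3 1 4 eq_refl)
   (H' 0 4 1 3 eq_refl)))%nat) as Q2.
  pose proof ((f_equal2 xorb (H' 0 2 3 4 eq_refl) (f_equal2 xorb (H' 0 3 2 4 eq_refl)
   (H' 0 4 2 3 eq_refl)))%nat) as Q1.
  pose proof ((f_equal2 xorb (H' 1 2 3 4 eq_refl) (f_equal2 xorb (H' 1 3 2 4 eq_refl)
   (H' 1 4 2 3 eq_refl)))%nat) as Q0.
  pose proof (f_equal2 xorb Q0 (f_equal2 xorb Q1 (f_equal2 xorb Q2
   (f_equal2 xorb Q3 Q4)))) as Q.
  (* On the right, each 4-subset leaves three sums of the form [b i j] plus [b j i], hence [true];
     five 4-subsets give [true] again. *)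
  rewrite (Hb 2 1)%nat, (Hb 3 1)%nat, (Hb 3 2)%nat, (Hb 4 1)%nat, (Hb 4 2)%nat, (Hb 4 3)%nat
    in Q by lia.
  match type of Q with ?L = ?R =>
    assert (L = false) by ring; assert (R = true) by ring; congruence end.
Qed.

(** * Polygonal connectedness of the region *)

Lemma dist_nonneg (p q : point) : 0 <= dist p q.
Proof. apply sqrt_pos. Qed.

Lemma dist_lerp (p q : point) (s t : R) :
  dist (lerp p q s) (lerp p q t) = Rabs (s - t) * dist p q.
Proof.
  unfold dist, lerp; simpl fst; simpl snd.
  rewrite <- (sqrt_Rsqr_abs (s - t)), <- sqrt_mult; [| apply Rle_0_sqr |].
  - f_equal; unfold Rsqr; ring.
  - apply Rplus_le_le_0_compat; apply pow2_ge_0.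
Qed.

Lemma dist_lerp_l (p q : point) (t : R) : 0 <= t -> dist p (lerp p q t) = t * dist p q.
Proof.
  intros H. rewrite <- (lerp_0 p q) at 1. rewrite dist_lerp, Rabs_left1; [f_equal |]; lra.
Qed.

Lemma dist_lerp_r (p q : point) (t : R) : t <= 1 -> dist (lerp p q t) q = (1 - t) * dist p q.
Proof.
  intros H. rewrite <- (lerp_1 p q) at 2. rewrite dist_lerp, Rabs_left1; [f_equal |]; lra.
Qed.

(** The squared distance to [x] attains its minimum on the compact segment, and this minimum is
    positive. *)
Lemma seg_closed (p q x : point) : ~ on_seg p q x ->
  exists delta, 0 < delta /\ forall y, dist y x < delta -> ~ on_seg p q y.
Proof.
  intros H.
  set (f := fun t => (fst (lerp p q t) - fst x) ^ 2 + (snd (lerp p q t) - snd x) ^ 2).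
  destruct (continuity_ab_min f 0 1) as [m [Hm Rm]]; [lra | intros; unfold f, lerp; simpl; reg |].
  assert (P : 0 < f m).
  { pose proof (pow2_ge_0 (fst (lerp p q m) - fst x)) as Px.
    pose proof (pow2_ge_0 (snd (lerp p q m) - snd x)) as Py.
    destruct (Rlt_le_dec 0 (f m)) as [E | E]; [easy |].
    destruct H. exists m. split; [easy |]. unfold f in E.
    apply point_eq; symmetry; apply Rminus_diag_uniq, Rsqr_0_uniq; rewrite Rsqr_pow2; lra. }
  exists (sqrt (f m)). split; [now apply sqrt_lt_R0 |].
  intros y Hy [t [Ht ->]].
  apply (Rlt_not_le _ _ Hy), sqrt_le_1_alt, Hm, Ht.
Qed.

Lemma boundary_closed (V : list point) (x : point) : ~ on_boundary V x ->
  exists delta, 0 < delta /\ forall y, dist y x < delta -> ~ on_boundary V y.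
Proof.
  intros H.
  assert (G : forall n, (n <= length V)%nat -> exists delta, 0 < delta /\
    forall y, dist y x < delta -> forall i, (i < n)%nat -> ~ on_edge V i y).
  { induction n as [| n IH]; intros Hn.
    - exists 1. split; [lra | intros; lia].
    - destruct IH as [d1 [P1 H1]]; [lia |].
      destruct (seg_closed (vtx V n) (vtx V (nxt V n)) x) as [d2 [P2 H2]].
      { intros E; apply H; exists n; split; [lia | easy]. }
      exists (Rmin d1 d2). split; [now apply Rmin_pos |].
      intros y Hy i Hi. pose proof (Rmin_l d1 d2). pose proof (Rmin_r d1 d2).
      destruct (Nat.eq_dec i n) as [-> | ne]; [apply H2; lra |].
      apply (H1 y); [lra | lia]. }
  destruct (G (length V)) as [d [P Hd]]; [lia |].
  exists d. split; [easy |]. intros y Hy [i [Hi E]]. exact (Hd y Hy i Hi E).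
Qed.

(** [t] is the supremum of the times before which the boundary is avoided; were the point there off
    the boundary, closedness would allow a later time. *)
Lemma first_boundary_hit (V : list point) (x y : point) : on_boundary V y ->
  exists t, 0 <= t <= 1 /\ on_boundary V (lerp x y t) /\
    forall s, 0 <= s < t -> ~ on_boundary V (lerp x y s).
Proof.
  intros Hy.
  set (E := fun t => 0 <= t <= 1 /\ forall s, 0 <= s < t -> ~ on_boundary V (lerp x y s)).
  destruct (completeness E) as [t [Hub Hlub]].
  { exists 1. intros t [Ht _]; lra. }
  { exists 0. split; [lra | intros s Hs; lra]. }
  assert (H0 : 0 <= t) by (apply Hub; split; [lra | intros s Hs; lra]).
  assert (H1 : t <= 1) by (apply Hlub; intros u [Hu _]; lra).
  assert (Hbefore : forall s, 0 <= s < t -> ~ on_boundary V (lerp x y s)).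
  { intros s Hs Hb.
    assert (t <= s); [| lra].
    apply Hlub. intros u [Hu Hu']. apply Rnot_lt_le; intros L.
    apply (Hu' s); [lra | easy]. }
  exists t. split; [easy |]. split; [| easy].
  apply NNPP; intros Hn.
  destruct (boundary_closed _ _ Hn) as [d [Pd Hd]].
  pose proof (dist_nonneg x y) as Pxy.
  (* The added [1] keeps the quotient defined when [x = y]; parameters within [eta] of [t] give
     points at distance less than [d]. *)
  set (eta := d / (dist x y + 1)).
  assert (Peta : 0 < eta) by (apply Rdiv_lt_0_compat; lra).
  assert (Heta : eta * (dist x y + 1) = d) by (unfold eta; field; lra).
  assert (t <> 1) by (intros ->; rewrite lerp_1 in Hn; contradiction).
  set (u := t + Rmin eta (1 - t)).
  assert (t < u /\ u <= t + eta /\ u <= 1) as [U1 [U2 U3]].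
  { unfold u. pose proof (Rmin_l eta (1 - t)). pose proof (Rmin_r eta (1 - t)).
    assert (0 < Rmin eta (1 - t)) by (apply Rmin_pos; lra). lra. }
  assert (u <= t); [| lra].
  apply Hub. split; [lra |]. intros s Hs.
  destruct (Rlt_le_dec s t); [apply Hbefore; lra |].
  apply Hd. rewrite dist_lerp, Rabs_right by lra. nra.
Qed.

(** Run through the segment in the first half of the time and along the escaping curve in the
    second. *)
Lemma escapes_along_segment (V : list point) (x y : point) :
  (forall t, 0 <= t <= 1 -> ~ on_boundary V (lerp x y t)) -> escapes V y -> escapes V x.
Proof.
  intros Hseg He M. destruct (He M) as [g [Cg [G0 [G1 Gb]]]].
  exists (fun s => if Rle_dec s (1 / 2) then lerp x y (2 * s) else g (2 * s - 1)).
  assert (L : forall t eps, 0 < eps -> exists delta, 0 < delta /\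
    forall s, Rabs (s - t) < delta -> dist (lerp x y (2 * s)) (lerp x y (2 * t)) < eps).
  { intros t eps Pe. pose proof (dist_nonneg x y).
    exists (eps / (2 * dist x y + 1)). split; [apply Rdiv_lt_0_compat; lra |].
    intros s Hs. rewrite dist_lerp.
    replace (2 * s - 2 * t) with (2 * (s - t)) by ring.
    rewrite Rabs_mult, (Rabs_right 2) by lra.
    apply (Rmult_lt_compat_r (2 * dist x y + 1)) in Hs; [| lra].
    unfold Rdiv in Hs; rewrite Rmult_assoc, Rinv_l in Hs by lra.
    pose proof (Rabs_pos (s - t)). nra. }
  assert (G : forall t eps, 1 / 2 <= t <= 1 -> 0 < eps -> exists delta, 0 < delta /\
    forall s, 1 / 2 <= s <= 1 -> Rabs (s - t) < delta ->
      dist (g (2 * s - 1)) (g (2 * t - 1)) < eps).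
  { intros t eps Ht Pe. destruct (Cg (2 * t - 1)) with (eps := eps) as [d [Pd Hd]]; [lra | easy |].
    exists (d / 2). split; [lra |]. intros s Hs Hst. apply Hd; [lra |].
    replace (2 * s - 1 - (2 * t - 1)) with (2 * (s - t)) by ring.
    rewrite Rabs_mult, (Rabs_right 2); lra. }
  (* The two halves agree at the junction, which gives continuity at time [1 / 2]. *)
  assert (J : g (2 * (1 / 2) - 1) = lerp x y (2 * (1 / 2))).
  { replace (2 * (1 / 2) - 1) with 0 by field. replace (2 * (1 / 2)) with 1 by field.
    now rewrite lerp_1. }
  split; [| split; [| split]].
  - intros t Ht eps Pe.
    destruct (Rtotal_order t (1 / 2)) as [T | [T | T]].
    + destruct (L t eps Pe) as [d [Pd Hd]].
      exists (Rmin d (1 / 2 - t)). split; [apply Rmin_pos; lra |].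
      intros s Hs Hst. pose proof (Rmin_l d (1 / 2 - t)). pose proof (Rmin_r d (1 / 2 - t)).
      pose proof (Rle_abs (s - t)).
      destruct (Rle_dec s (1 / 2)), (Rle_dec t (1 / 2)); try lra. apply Hd; lra.
    + subst t. destruct (L (1 / 2) eps Pe) as [d [Pd Hd]].
      destruct (G (1 / 2) eps) as [d' [Pd' Hd']]; [lra | easy |].
      exists (Rmin d d'). split; [now apply Rmin_pos |].
      intros s Hs Hst. pose proof (Rmin_l d d'). pose proof (Rmin_r d d').
      destruct (Rle_dec s (1 / 2)), (Rle_dec (1 / 2) (1 / 2)); try lra.
      * apply Hd; lra.
      * rewrite <- J. apply Hd'; lra.
    + destruct (G t eps) as [d [Pd Hd]]; [lra | easy |].
      exists (Rmin d (t - 1 / 2)). split; [apply Rmin_pos; lra |].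
      intros s Hs Hst. pose proof (Rmin_l d (t - 1 / 2)). pose proof (Rmin_r d (t - 1 / 2)).
      pose proof (Rle_abs (- (s - t))). rewrite Rabs_Ropp in *.
      destruct (Rle_dec s (1 / 2)), (Rle_dec t (1 / 2)); try lra. apply Hd; lra.
  - destruct (Rle_dec 0 (1 / 2)); [| lra]. rewrite Rmult_0_r. apply lerp_0.
  - destruct (Rle_dec 1 (1 / 2)); [lra |].
    now replace (2 * 1 - 1) with 1 by ring.
  - intros t Ht. destruct (Rle_dec t (1 / 2)); [apply Hseg | apply Gb]; lra.
Qed.

Lemma in_poly_boundary (V : list point) (x : point) : on_boundary V x -> in_poly V x.
Proof.
  intros H He. destruct (He 0) as [g [_ [G0 [_ Gb]]]].
  apply (Gb 0); [lra | now rewrite G0].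
Qed.

Definition seg_inside (V : list point) (a b : point) : Prop :=
  forall t, 0 <= t <= 1 -> in_poly V (lerp a b t).

(** Walk from [x] to the first boundary point. An earlier point that escapes is reached from [x] off
    the boundary, so [x] would escape too. *)
Lemma in_poly_sees_boundary (V : list point) (x y : point) :
  in_poly V x -> on_boundary V y -> exists z, on_boundary V z /\ seg_inside V x z.
Proof.
  intros Hx Hy. destruct (first_boundary_hit V x y Hy) as [t [Ht [Hb Hbefore]]].
  exists (lerp x y t). split; [easy |]. intros s Hs.
  assert (E : forall r, lerp x (lerp x y t) r = lerp x y (r * t))
    by (intros r; apply point_eq; simpl; ring).
  destruct (Req_dec s 1) as [-> | Hs1]; [rewrite lerp_1; now apply in_poly_boundary |].
  destruct (Req_dec t 0) as [-> | Ht0]; [rewrite E, Rmult_0_r; now rewrite lerp_0 |].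
  intros He. apply Hx. apply (escapes_along_segment V x (lerp x (lerp x y t) s)); [| easy].
  intros r Hr.
  replace (lerp x (lerp x (lerp x y t) s) r) with (lerp x y (r * s * t))
    by (apply point_eq; simpl; ring).
  apply Hbefore. split; [apply Rmult_le_pos; [apply Rmult_le_pos |]; lra |].
  assert (r * s < 1) by nra. nra.
Qed.

Definition connected (V : list point) (a b : point) : Prop :=
  exists pts, chain_inside V a (pts ++ [b]).

Lemma chain_inside_app (V : list point) (a b : point) (l l' : list point) :
  chain_inside V a (l ++ [b]) -> chain_inside V b l' -> chain_inside V a (l ++ b :: l').
Proof.
  revert a; induction l as [| q l IH]; intros a; simpl; [tauto |].
  intros [H1 H2] H3. split; [easy |]. now apply IH.
Qed.

Lemma chain_len_app (a b : point) (l l' : list point) :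
  chain_len a (l ++ b :: l') = chain_len a (l ++ [b]) + chain_len b l'.
Proof.
  revert a; induction l as [| q l IH]; intros a; simpl; [ring |]. rewrite IH; ring.
Qed.

Lemma chain_len_nonneg (a : point) (l : list point) : 0 <= chain_len a l.
Proof.
  revert a; induction l as [| q l IH]; intros a; simpl; [lra |].
  pose proof (dist_nonneg a q). specialize (IH q). lra.
Qed.

Lemma connected_trans (V : list point) (a b c : point) :
  connected V a b -> connected V b c -> connected V a c.
Proof.
  intros [l H] [l' H']. exists (l ++ b :: l').
  rewrite <- app_assoc. now apply chain_inside_app.
Qed.

Lemma connected_seg (V : list point) (a b : point) : seg_inside V a b -> connected V a b.
Proof. intros H. exists []. now split. Qed.

Lemma seg_inside_sym (V : list point) (a b : point) : seg_inside V a b -> seg_inside V b a.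
Proof. intros H t Ht. rewrite lerp_flip. apply H; lra. Qed.

Lemma connected_sym (V : list point) (a b : point) : connected V a b -> connected V b a.
Proof.
  intros [l H]. revert a H; induction l as [| q l IH]; intros a [H1 H2].
  - apply connected_seg, seg_inside_sym; exact H1.
  - apply (connected_trans V b q a); [now apply IH |].
    apply connected_seg, seg_inside_sym; exact H1.
Qed.

Lemma edge_inside (V : list point) (i : nat) (x y : point) :
  (i < length V)%nat -> on_edge V i x -> on_edge V i y -> seg_inside V x y.
Proof.
  intros Hi [s [Hs ->]] [t [Ht ->]] r Hr. apply in_poly_boundary. exists i. split; [easy |].
  exists ((1 - r) * s + r * t). split; [split; nra |]. apply point_eq; simpl; ring.
Qed.

Lemma connected_vertex (V : list point) (i : nat) :
  (i < length V)%nat -> connected V (vtx V 0) (vtx V i).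
Proof.
  induction i as [| i IH]; intros Hi.
  - apply connected_seg, (edge_inside V 0); [easy | apply on_seg_l ..].
  - apply (connected_trans V _ (vtx V i)); [apply IH; lia |].
    apply connected_seg, (edge_inside V i); [lia | apply on_seg_l |].
    unfold on_edge, nxt. rewrite Nat.mod_small by easy. apply on_seg_r.
Qed.

(** Every point of the region sees the boundary, along which one can walk to vertex [0]. Hence the
    infimum defining [gdist] ranges over a nonempty set. *)
Lemma in_poly_connected (V : list point) (a b : point) :
  (0 < length V)%nat -> in_poly V a -> in_poly V b -> connected V a b.
Proof.
  intros HV.
  assert (G : forall x, in_poly V x -> connected V x (vtx V 0)).
  { intros x Hx. destruct (in_poly_sees_boundary V x (vtx V 0) Hx) as [z [[i [Hi Hz]] Hs]].
    { exists 0%nat. split; [easy | apply on_seg_l]. }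
    apply (connected_trans V x z); [now apply connected_seg |].
    apply (connected_trans V z (vtx V i)).
    - apply connected_seg, (edge_inside V i); [easy.. | apply on_seg_l].
    - apply connected_sym, connected_vertex, Hi. }
  intros Ha Hb. apply (connected_trans V a (vtx V 0)); [now apply G |].
  now apply connected_sym, G.
Qed.

(** * Almost shortest chains *)

(** Lengths are nonnegative and some chain exists, so the infimum is finite and [real] returns it
    rather than its default [0]. *)
Lemma gdist_glb (V : list point) (a b : point) : connected V a b ->
  (forall pts, chain_inside V a (pts ++ [b]) -> gdist V a b <= chain_len a (pts ++ [b])) /\
  (forall m, gdist V a b < m ->
     exists pts, chain_inside V a (pts ++ [b]) /\ chain_len a (pts ++ [b]) < m).
Proof.
  intros [l0 H0]. unfold gdist.
  set (E := fun l => exists pts, chain_inside V a (pts ++ [b]) /\ l = chain_len a (pts ++ [b])).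
  destruct (Glb_Rbar_correct E) as [Hlb Hglb].
  assert (P : Rbar_le 0 (Glb_Rbar E)).
  { apply Hglb. intros x [pts [_ ->]]. apply chain_len_nonneg. }
  assert (Q : Rbar_le (Glb_Rbar E) (chain_len a (l0 ++ [b]))).
  { apply Hlb. now exists l0. }
  destruct (Glb_Rbar E) as [g | |]; [| contradiction ..]. simpl. split.
  - intros pts H. apply (Hlb (chain_len a (pts ++ [b]))). now exists pts.
  - intros m Hm. apply NNPP; intros Hn.
    apply (Rlt_not_le _ _ Hm). apply (Hglb m).
    intros x [pts [Hp ->]]. simpl. apply Rnot_lt_le; intros L.
    apply Hn. now exists pts.
Qed.

Lemma seg_split (V : list point) (a q y : point) :
  seg_inside V a q -> on_seg a q y ->
  seg_inside V a y /\ seg_inside V y q /\ dist a y + dist y q = dist a q.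
Proof.
  intros H [t [Ht ->]]. split; [| split].
  - intros s Hs. replace (lerp a (lerp a q t) s) with (lerp a q (s * t))
      by (apply point_eq; simpl; ring).
    apply H; split; nra.
  - intros s Hs. replace (lerp (lerp a q t) q s) with (lerp a q (t + s * (1 - t)))
      by (apply point_eq; simpl; ring).
    apply H; split; nra.
  - rewrite dist_lerp_l, dist_lerp_r by lra. ring.
Qed.

Lemma chain_split (V : list point) (a b y : point) (pts : list point) :
  chain_inside V a (pts ++ [b]) -> on_chain a (pts ++ [b]) y ->
  exists l l', chain_inside V a (l ++ [y]) /\ chain_inside V y (l' ++ [b]) /\
    chain_len a (l ++ [y]) + chain_len y (l' ++ [b]) = chain_len a (pts ++ [b]).
Proof.
  revert a; induction pts as [| q pts IH]; intros a; simpl.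
  - intros [H _] [Hy | []]. destruct (seg_split V a b y H Hy) as [H1 [H2 H3]].
    exists [], []. simpl. repeat split; try easy. lra.
  - intros [H Hc] [Hy | Hy].
    + destruct (seg_split V a q y H Hy) as [H1 [H2 H3]].
      exists [], (q :: pts). simpl. repeat split; try easy. lra.
    + destruct (IH q Hc Hy) as [l [l' [H1 [H2 H3]]]].
      exists (q :: l), l'. simpl. repeat split; try easy. lra.
Qed.

(* At a common point the two chains could exchange their tails. *)
Lemma short_chains_disjoint (V : list point) (c d u w : point) (lu lw : list point) :
  chain_inside V c (lu ++ [u]) -> chain_inside V d (lw ++ [w]) ->
  chain_len c (lu ++ [u]) < gdist V c w -> chain_len d (lw ++ [w]) < gdist V d u ->
  chain_disjoint c (lu ++ [u]) d (lw ++ [w]).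
Proof.
  intros Hu Hw Lu Lw y Yu Yw.
  destruct (chain_split V c u y lu Hu Yu) as [l1 [l2 [A1 [A2 A3]]]].
  destruct (chain_split V d w y lw Hw Yw) as [m1 [m2 [B1 [B2 B3]]]].
  assert (G : forall a b l l', chain_inside V a (l ++ [y]) -> chain_inside V y (l' ++ [b]) ->
    gdist V a b <= chain_len a (l ++ [y]) + chain_len y (l' ++ [b])).
  { intros a b l l' H H'. rewrite <- chain_len_app.
    change (l ++ y :: l' ++ [b]) with (l ++ (y :: l') ++ [b]). rewrite app_assoc.
    assert (K : chain_inside V a ((l ++ y :: l') ++ [b])).
    { rewrite <- app_assoc. now apply chain_inside_app. }
    apply gdist_glb; [now exists (l ++ y :: l') | easy]. }
  pose proof (G _ _ _ _ A1 B2). pose proof (G _ _ _ _ B1 A2). lra.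
Qed.

(** Finitely many strict inequalities leave a common gap, which makes room for chains that are only
    almost shortest. *)
Lemma strict_lower_bound (P : nat -> Prop) (f : nat -> R) (r : R) (n : nat) :
  (forall k, (k < n)%nat -> P k -> r < f k) ->
  exists m, r < m /\ forall k, (k < n)%nat -> P k -> m <= f k.
Proof.
  induction n as [| n IH]; intros H.
  - exists (r + 1). split; [lra | intros; lia].
  - destruct IH as [m [Hm H']]; [intros k Hk; apply H; lia |].
    destruct (classic (P n)) as [Pn | Pn].
    + exists (Rmin m (f n)). split; [apply Rmin_glb_lt; [easy | apply H; [lia | easy]] |].
      intros k Hk Pk. destruct (Nat.eq_dec k n) as [-> | ne]; [apply Rmin_r |].
      apply (Rle_trans _ m); [apply Rmin_l | apply H'; [lia | easy]].
    + exists m. split; [easy |]. intros k Hk Pk.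
      destruct (Nat.eq_dec k n) as [-> | ne]; [easy | apply H'; [lia | easy]].
Qed.

(** [c i j] is the hub of the edge [ij]. Its two chains are shorter than the distance from the hub
    to each of the other three points, so chains of independent edges are disjoint and [edge_parity]
    yields the system refuted by [K5_parity_contradiction]. *)
Lemma no_five_points_with_empty_disks (V : list point) (x : nat -> point)
    (c : nat -> nat -> point) :
  (0 < length V)%nat ->
  (forall i, (i < 5)%nat -> in_poly V (x i)) ->
  (forall i j, (i < j < 5)%nat -> x i <> x j /\ in_poly V (c i j) /\
     gdist V (c i j) (x i) = gdist V (c i j) (x j)) ->
  (forall i j k, (i < j < 5)%nat -> (k < 5)%nat -> k <> i -> k <> j ->
     gdist V (c i j) (x i) < gdist V (c i j) (x k)) -> False.
Proof.
  intros HV Hx Hc Hempty.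
  destruct (choice (fun (ij : nat * nat) (L : list point * list point) =>
    let (i, j) := ij in let (li, lj) := L in
    (i < j < 5)%nat ->
      chain_inside V (c i j) (li ++ [x i]) /\ chain_inside V (c i j) (lj ++ [x j]) /\
      forall k, (k < 5)%nat -> k <> i /\ k <> j ->
        chain_len (c i j) (li ++ [x i]) < gdist V (c i j) (x k) /\
        chain_len (c i j) (lj ++ [x j]) < gdist V (c i j) (x k))) as [L HL].
  { intros [i j]. destruct (classic (i < j < 5)%nat) as [Hij | Hij]; [| now exists ([], [])].
    destruct (Hc i j Hij) as [_ [Pc Ec]].
    destruct (strict_lower_bound (fun k => k <> i /\ k <> j) (fun k => gdist V (c i j) (x k))
      (gdist V (c i j) (x i)) 5) as [m [Hm Hk]].
    { intros k Hk [k1 k2]. now apply Hempty. }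
    destruct (gdist_glb V (c i j) (x i)) as [_ Gi].
    { apply in_poly_connected; [easy.. | apply Hx; lia]. }
    destruct (gdist_glb V (c i j) (x j)) as [_ Gj].
    { apply in_poly_connected; [easy.. | apply Hx; lia]. }
    destruct (Gi m Hm) as [li [Ii Li]]. rewrite Ec in Hm.
    destruct (Gj m Hm) as [lj [Ij Lj]].
    exists (li, lj). intros _. repeat split; try easy;
      eapply Rlt_le_trans; try eassumption; now apply Hk. }
  (* [e i j k] counts modulo 2 the crossings of the edge [ij] with the ray from [x k]. *)
  apply (K5_parity_contradiction
    (fun i j k => xorb (ray_parity (x k) (c i j) (fst (L (i, j)) ++ [x i]))
                       (ray_parity (x k) (c i j) (snd (L (i, j)) ++ [x j])))
    (fun i j => holds (below (x i) (x j)))).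
  - intros i j Hij. rewrite xorb_true_l. apply holds_below_flip. now apply Hc.
  - intros i j k l Hij Hkl ik il jk jl.
    pose proof (HL (i, j)) as H1. pose proof (HL (k, l)) as H2. simpl in H1, H2.
    destruct (L (i, j)) as [li lj], (L (k, l)) as [lk ll].
    destruct (H1 Hij) as [Ii [Ij A]], (H2 Hkl) as [Ik [Il B]].
    destruct (A k) as [A1 A2]; [lia | lia |]. destruct (A l) as [A3 A4]; [lia | lia |].
    destruct (B i) as [B1 B2]; [lia | lia |]. destruct (B j) as [B3 B4]; [lia | lia |].
    simpl fst; simpl snd.
    apply edge_parity; rewrite ?last_last; try easy; now apply (short_chains_disjoint V).
Qed.

(** * Union bound over tuples *)

Definition sum_over {A : Type} (l : list A) (f : A -> nat) : nat := list_sum (map f l).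

Definition indicator (P : Prop) : nat := if holds P then 1 else 0.

Definition upd {A : Type} (g : nat -> A) (k : nat) (x : A) (i : nat) : A :=
  if (i =? k)%nat then x else g i.

(** Tuples are functions on [nat]: the coordinates below [m] range over [l] with repetition, the
    others come from [g]. *)
Fixpoint tuple_sum {A : Type} (l : list A) (m : nat) (F : (nat -> A) -> nat)
    (g : nat -> A) : nat :=
  match m with
  | O => F g
  | S m' => sum_over l (fun x => tuple_sum l m' F (upd g m' x))
  end.

Local Open Scope nat_scope.

Lemma sum_over_ext {A : Type} (l : list A) (f g : A -> nat) :
  (forall x, f x = g x) -> sum_over l f = sum_over l g.
Proof. intros H. unfold sum_over. f_equal. now apply map_ext. Qed.

Lemma sum_over_le {A : Type} (l : list A) (f g : A -> nat) :
  (forall x, In x l -> f x <= g x) -> sum_over l f <= sum_over l g.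
Proof.
  unfold sum_over. induction l as [| a l IH]; intros H; simpl; [lia |].
  pose proof (H a (or_introl eq_refl)).
  pose proof (IH (fun x Hx => H x (or_intror Hx))). lia.
Qed.

Lemma sum_over_const {A : Type} (l : list A) (c : nat) :
  sum_over l (fun _ => c) = length l * c.
Proof. unfold sum_over. induction l; simpl; lia. Qed.

Lemma sum_over_add {A : Type} (l : list A) (f g : A -> nat) :
  sum_over l (fun x => f x + g x) = sum_over l f + sum_over l g.
Proof. unfold sum_over. induction l; simpl; lia. Qed.

Lemma sum_over_mul {A : Type} (l : list A) (c : nat) (f : A -> nat) :
  sum_over l (fun x => c * f x) = c * sum_over l f.
Proof. unfold sum_over. induction l; simpl; lia. Qed.

Lemma sum_over_swap {A B : Type} (l : list A) (l' : list B) (f : A -> B -> nat) :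
  sum_over l (fun x => sum_over l' (f x)) = sum_over l' (fun y => sum_over l (fun x => f x y)).
Proof.
  induction l as [| a l IH].
  - transitivity (sum_over l' (fun _ => 0)); [now rewrite sum_over_const, Nat.mul_0_r | easy].
  - change (sum_over l' (f a) + sum_over l (fun x => sum_over l' (f x)) =
      sum_over l' (fun y => f a y + sum_over l (fun x => f x y))).
    now rewrite sum_over_add, IH.
Qed.

Lemma upd_same {A : Type} (g : nat -> A) (k : nat) (x : A) : upd g k x k = x.
Proof. unfold upd. now rewrite Nat.eqb_refl. Qed.

Lemma upd_other {A : Type} (g : nat -> A) (k i : nat) (x : A) : i <> k -> upd g k x i = g i.
Proof. intros H. unfold upd. now rewrite (proj2 (Nat.eqb_neq i k) H). Qed.

Lemma upd_comm {A : Type} (g : nat -> A) (k m : nat) (x y : A) :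
  k <> m -> upd (upd g k x) m y = upd (upd g m y) k x.
Proof.
  intros H. apply functional_extensionality; intros i. unfold upd.
  destruct (Nat.eqb_spec i m), (Nat.eqb_spec i k); subst; easy.
Qed.

Lemma upd_upd {A : Type} (g : nat -> A) (k : nat) (x y : A) : upd (upd g k x) k y = upd g k y.
Proof.
  apply functional_extensionality; intros i. unfold upd. now destruct (Nat.eqb_spec i k).
Qed.

Lemma tuple_sum_sum_over {A B : Type} (l : list A) (l' : list B) (m : nat)
    (F : B -> (nat -> A) -> nat) (g : nat -> A) :
  tuple_sum l m (fun h => sum_over l' (fun y => F y h)) g =
  sum_over l' (fun y => tuple_sum l m (F y) g).
Proof.
  revert g; induction m as [| m IH]; intros g; simpl; [easy |].
  rewrite <- sum_over_swap. apply sum_over_ext; intros x. apply IH.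
Qed.

Lemma tuple_sum_upd {A : Type} (l : list A) (m k : nat) (x : A)
    (F : (nat -> A) -> nat) (g : nat -> A) :
  m <= k -> tuple_sum l m (fun h => F (upd h k x)) g = tuple_sum l m F (upd g k x).
Proof.
  revert g; induction m as [| m IH]; intros g H; simpl; [easy |].
  apply sum_over_ext; intros y. rewrite IH by lia. f_equal. apply upd_comm; lia.
Qed.

(** Redrawing one coordinate of a uniform tuple does not change the distribution; the factor counts
    the values of the overwritten draw. *)
Lemma tuple_sum_resample {A : Type} (l : list A) (m k : nat)
    (F : (nat -> A) -> nat) (g : nat -> A) : k < m ->
  sum_over l (fun x => tuple_sum l m (fun h => F (upd h k x)) g) = length l * tuple_sum l m F g.
Proof.
  revert g; induction m as [| m IH]; intros g H; [lia |]. simpl.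
  destruct (Nat.eq_dec k m) as [-> | ne].
  - rewrite <- sum_over_mul. apply sum_over_ext; intros x.
    rewrite <- sum_over_const. apply sum_over_ext; intros y.
    rewrite tuple_sum_upd by lia. now rewrite upd_upd.
  - rewrite sum_over_swap, <- sum_over_mul. apply sum_over_ext; intros y. apply IH; lia.
Qed.

Lemma tuple_sum_le_const {A : Type} (l : list A) (m B : nat)
    (F : (nat -> A) -> nat) (g : nat -> A) :
  (forall h, F h <= B) -> tuple_sum l m F g <= length l ^ m * B.
Proof.
  intros H. revert g; induction m as [| m IH]; intros g; simpl; [specialize (H g); lia |].
  rewrite <- Nat.mul_assoc, <- sum_over_const. apply sum_over_le; intros x _. apply IH.
Qed.

Lemma sum_over_small_term {A : Type} (l : list A) (f : A -> nat) (c : nat) :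
  sum_over l f < length l * c -> exists x, In x l /\ f x < c.
Proof.
  intros H. apply NNPP; intros Hn. apply (Nat.lt_irrefl (length l * c)).
  apply (Nat.le_lt_trans _ (sum_over l f)); [| easy].
  rewrite <- sum_over_const. apply sum_over_le; intros x Hx.
  apply Nat.nlt_ge; intros L. apply Hn. now exists x.
Qed.

(** An average below [1] forces the value [0]. Coordinates are fixed one at a time from the last,
    each choice keeping the remaining average below [1]. *)
Lemma tuple_sum_zero {A : Type} (l : list A) (m : nat) (F : (nat -> A) -> nat) (g : nat -> A) :
  tuple_sum l m F g < length l ^ m ->
  exists h, (forall i, i < m -> In (h i) l) /\ (forall i, m <= i -> h i = g i) /\ F h = 0.
Proof.
  revert g; induction m as [| m IH]; intros g; simpl.
  - intros H. exists g. repeat split; [lia | lia].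
  - intros H. destruct (sum_over_small_term _ _ _ H) as [x [Hx Hlt]].
    destruct (IH _ Hlt) as [h [H1 [H2 H3]]]. exists h. split; [| split; [| easy]].
    + intros i Hi. destruct (Nat.eq_dec i m) as [-> | ne]; [| apply H1; lia].
      now rewrite H2, upd_same.
    + intros i Hi. rewrite H2, upd_other by lia. easy.
Qed.

(* Union bound for tuples drawn with repetition: each event [(k, E)] has
   conditional probability at most [B / length l] given the coordinates other
   than the [k]-th. *)
Lemma tuple_avoiding_events {A : Type} (l : list A) (g : nat -> A) (m B : nat)
    (Ev : list (nat * ((nat -> A) -> Prop))) :
  (forall k E, In (k, E) Ev -> k < m /\
     forall h, sum_over l (fun x => indicator (E (upd h k x))) <= B) ->
  length Ev * B < length l ->
  exists h, (forall i, i < m -> In (h i) l) /\ forall k E, In (k, E) Ev -> ~ E h.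
Proof.
  intros HE Hlt.
  set (F := fun h : nat -> A => sum_over Ev (fun e => indicator (snd e h))).
  destruct (tuple_sum_zero l m F g) as [h [H1 [_ H3]]].
  - unfold F. rewrite tuple_sum_sum_over.
    (* The factor [length l] pays for redrawing the coordinate of each event, which is then summed
       over with the others fixed. *)
    apply (Nat.mul_lt_mono_pos_l (length l)); [lia |].
    rewrite <- sum_over_mul.
    apply (Nat.le_lt_trans _ (sum_over Ev (fun _ => length l ^ m * B))).
    + apply sum_over_le; intros [k E] HkE. destruct (HE k E HkE) as [Hk Hb]. simpl.
      rewrite <- (tuple_sum_resample l m k (fun h => indicator (E h))) by easy.
      rewrite <- (tuple_sum_sum_over l l m (fun x h => indicator (E (upd h k x)))).
      apply tuple_sum_le_const, Hb.
    + rewrite sum_over_const.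
      assert (0 < length l ^ m) by (apply Nat.neq_0_lt_0, Nat.pow_nonzero; lia). nia.
  - exists h. split; [easy |]. intros k E HkE Eh.
    assert (L : forall Ev', In (k, E) Ev' ->
      indicator (E h) <= sum_over Ev' (fun e => indicator (snd e h))).
    { intros Ev'. unfold sum_over. induction Ev' as [| e Ev' IH]; simpl; [easy |].
      intros [-> | Hin]; [simpl; lia | specialize (IH Hin); lia]. }
    specialize (L Ev HkE). unfold F in H3. unfold indicator at 1 in L.
    rewrite holds_true in L by easy. lia.
Qed.

Lemma sum_over_indicator {A : Type} (l : list A) (P : A -> Prop) (f : A -> bool) :
  (forall x, P x <-> f x = true) ->
  sum_over l (fun x => indicator (P x)) = length (filter f l).
Proof.
  intros H. unfold sum_over, indicator. induction l as [| a l IH]; simpl; [easy |].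
  rewrite IH. destruct (f a) eqn:E.
  - rewrite holds_true; [easy | now apply H].
  - rewrite holds_false; [easy |]. rewrite H, E. easy.
Qed.

Lemma sum_over_indicator_eq {A : Type} (l : list A) (a : A) :
  NoDup l -> sum_over l (fun x => indicator (a = x)) <= 1.
Proof.
  unfold sum_over, indicator. induction 1 as [| b l Hb Hl IH]; simpl; [lia |].
  destruct (classic (a = b)) as [-> | ne].
  - rewrite holds_true by easy.
    assert (Z : sum_over l (fun x => indicator (b = x)) <= sum_over l (fun _ => 0)).
    { apply sum_over_le; intros x Hx. unfold indicator. rewrite holds_false; [easy |].
      now intros ->. }
    rewrite sum_over_const in Z. unfold sum_over, indicator in Z. lia.
  - rewrite (holds_false (a = b)) by easy. exact IH.
Qed.

(** There are [10] pairs that must not coincide and [30] triples to avoid, whence [40]. A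
    coincidence is charged to its second coordinate, a triple to its third; [1 <= B] lets [B] bound
    both kinds. *)
Lemma five_points_avoiding_triples (l : list point) (T : point -> point -> point -> Prop)
    (B : nat) :
  NoDup l -> 1 <= B -> 40 * B < length l ->
  (forall u v, sum_over l (fun w => indicator (T u v w)) <= B) ->
  exists x : nat -> point, (forall i, i < 5 -> In (x i) l) /\
    (forall i j, i < j < 5 -> x i <> x j) /\
    (forall i j k, i < j < 5 -> k < 5 -> k <> i -> k <> j -> ~ T (x i) (x j) (x k)).
Proof.
  intros Hl HB Hlen HT.
  set (pairs := filter (fun ij => fst ij <? snd ij) (list_prod (seq 0 5) (seq 0 5))).
  set (triples := filter (fun ijk => negb (snd ijk =? fst (fst ijk)) &&
                                     negb (snd ijk =? snd (fst ijk)))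
                    (list_prod pairs (seq 0 5))).
  assert (Hpairs : forall i j, In (i, j) pairs <-> i < j < 5).
  { intros i j. unfold pairs. rewrite filter_In, in_prod_iff, !in_seq, Nat.ltb_lt. simpl. lia. }
  assert (Htriples : forall i j k, In (i, j, k) triples <->
    i < j < 5 /\ k < 5 /\ k <> i /\ k <> j).
  { intros i j k. unfold triples.
    rewrite filter_In, in_prod_iff, Hpairs, in_seq, andb_true_iff, !negb_true_iff, !Nat.eqb_neq.
    simpl. lia. }
  destruct (tuple_avoiding_events l (fun _ => (0, 0)%R) 5 B
    (map (fun ij => (snd ij, fun h : nat -> point => h (fst ij) = h (snd ij))) pairs ++
     map (fun ijk => (snd ijk, fun h => T (h (fst (fst ijk))) (h (snd (fst ijk))) (h (snd ijk))))
       triples)) as [x [Hx HE]].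
  - intros k E HkE. apply in_app_or in HkE. destruct HkE as [H | H]; apply in_map_iff in H.
    + destruct H as [[i j] [Q Hij]]. injection Q as <- <-. apply Hpairs in Hij. simpl.
      split; [lia |]. intros h.
      apply (Nat.le_trans _ 1); [| easy].
      rewrite (sum_over_ext _ _ (fun y => indicator (h i = y)));
        [now apply sum_over_indicator_eq |].
      intros y. now rewrite upd_same, upd_other by lia.
    + destruct H as [[[i j] k'] [Q Hijk]]. injection Q as <- <-. apply Htriples in Hijk. simpl.
      split; [lia |]. intros h.
      rewrite (sum_over_ext _ _ (fun y => indicator (T (h i) (h j) y))); [apply HT |].
      intros y. now rewrite upd_same, !upd_other by lia.
  - rewrite length_app, !length_map. exact Hlen.
  - exists x. split; [easy |]. split.
    + intros i j Hij E. apply (HE j (fun h => h i = h j)); [| easy].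
      apply in_or_app; left. apply in_map_iff. exists (i, j). now rewrite Hpairs.
    + intros i j k Hij Hk ki kj E. apply (HE k (fun h => T (h i) (h j) (h k))); [| easy].
      apply in_or_app; right. apply in_map_iff. exists (i, j, k). now rewrite Htriples.
Qed.

(** * Counting points in geodesic disks *)

Lemma count_in_disk_ge_2 (V S : list point) (c u v : point) (r : R) :
  In u S -> In v S -> u <> v -> gdist V c u = r -> gdist V c v = r ->
  2 <= count_in_disk V S c r.
Proof.
  intros Hu Hv Huv Eu Ev. unfold count_in_disk.
  change 2 with (length [u; v]). apply NoDup_incl_length.
  - constructor; [intros [-> | []]; easy | constructor; [easy | constructor]].
  - intros w [<- | [<- | []]]; apply filter_In; (split; [easy |]);
      destruct Rle_dec as [| n]; [easy | destruct n; lra | easy | destruct n; lra].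
Qed.

Local Open Scope R_scope.

Theorem theorem1 :
  forall (n : nat), (5 <= n)%nat ->
  forall (V : list point), simple_polygon V ->
  forall (S : list point), NoDup S -> length S = n ->
    (forall s, In s S -> in_poly V s) ->
    general_position V S ->
    exists u v, In u S /\ In v S /\ u <> v /\
      forall (c : point) (r : R), in_poly V c ->
        gdist V c u = r -> gdist V c v = r ->
        (ceil_div (n - 2) 60 <= count_in_disk V S c r)%nat.
Proof.
  intros n Hn V [HV _] S HS Hlen Hin _.
  set (k := ceil_div (n - 2) 60).
  (* Rounding up adds at most [59] to [n - 2]. *)
  assert (Hk : (60 * k <= n + 57)%nat).
  { unfold k, ceil_div. pose proof (Nat.Div0.mul_div_le (n - 2 + 60 - 1) 60). lia. }
  (* Any two points settle [k <= 2], as a disk through them contains both. *)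
  destruct (le_lt_dec k 2) as [Hk2 | Hk2].
  - destruct S as [| u [| v S]]; [simpl in Hlen; lia | simpl in Hlen; lia |].
    assert (u <> v) by (inversion HS as [| ? ? Hu]; intros ->; apply Hu; now left).
    exists u, v. split; [now left |]. split; [right; now left |]. split; [easy |].
    intros c r _ Eu Ev. apply (Nat.le_trans _ 2); [easy |].
    apply (count_in_disk_ge_2 V (u :: v :: S) c u v r); simpl; tauto.
  - apply NNPP; intros Hno.
    (* Choose for each pair of distinct points of [S] the center of a disk through both with fewer
       than [k] points; other pairs get an arbitrary center. *)
    destruct (choice (fun (uv : point * point) (c : point) =>
      In (fst uv) S -> In (snd uv) S -> fst uv <> snd uv ->
      in_poly V c /\ gdist V c (fst uv) = gdist V c (snd uv) /\
      (count_in_disk V S c (gdist V c (fst uv)) < k)%nat)) as [ctr Hctr].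
    { intros [u v]. simpl.
      destruct (classic (In u S /\ In v S /\ u <> v)) as [[Hu [Hv Huv]] | N];
        [| exists u; tauto].
      apply NNPP; intros N. apply Hno. exists u, v. repeat split; try easy.
      intros c r Hc Eu Ev. apply Nat.nlt_ge; intros L. apply N. exists c.
      intros _ _ _. subst r. rewrite Ev. easy. }
    (* [w] lies in the disk chosen for [u] and [v]. The guard makes the count bounded for all
       pairs. *)
    set (T := fun u v w => (In u S /\ In v S /\ u <> v) /\
      gdist V (ctr (u, v)) w <= gdist V (ctr (u, v)) u).
    (* A chosen disk has at most [k - 1] points, and [60 * k <= n + 57] gives [40 * (k - 1) < n]. *)
    destruct (five_points_avoiding_triples S T (k - 1)) as [x [Hx [Hinj Hgood]]];
      [easy | lia | lia | |].
    { intros u v. destruct (classic (In u S /\ In v S /\ u <> v)) as [H | N].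
      - destruct (Hctr (u, v)) as [_ [_ Hc]]; [easy.. |]. simpl in Hc.
        rewrite (sum_over_indicator S _ (fun s =>
          if Rle_dec (gdist V (ctr (u, v)) s) (gdist V (ctr (u, v)) u) then true else false)).
        + unfold count_in_disk in Hc. lia.
        + intros w. unfold T. destruct Rle_dec; split; try easy; tauto.
      - apply (Nat.le_trans _ (sum_over S (fun _ => 0%nat)));
          [| rewrite sum_over_const; lia].
        apply sum_over_le; intros w _. unfold indicator. rewrite holds_false; [lia |].
        unfold T; tauto. }
    apply (no_five_points_with_empty_disks V x (fun i j => ctr (x i, x j))).
    + lia.
    + intros i Hi. apply Hin, Hx, Hi.
    + intros i j Hij. destruct (Hctr (x i, x j)) as [H1 [H2 _]].
      * apply Hx; lia.
      * apply Hx; lia.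
      * now apply Hinj.
      * split; [now apply Hinj | easy].
    + intros i j l Hij Hl li lj. apply Rnot_le_lt; intros L.
      apply (Hgood i j l); try easy. split; [| easy].
      split; [apply Hx; lia | split; [apply Hx; lia | now apply Hinj]].
Qed.
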